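(* Let $\mathbb{F}$ be an algebraically closed field of characteristic $0$ and let $f\in\mathbb{F}[x_1,\ldots,x_n]$ with $d_0 := \deg(\mathrm{rad}(f)) > 0$. Let $y$ be a new variable and, for $\alpha=(\alpha_1,\dots,\alpha_n),\beta=(\beta_1,\dots,\beta_n)\in\mathbb{F}^n$, let $\tau$ be the map $x_i \mapsto \alpha_i y + x_i + \beta_i$ ($i\in[n]$). Then for a random choice of $\alpha,\beta$ (i.e. for all $(\alpha,\beta)$ outside a proper Zariski-closed subset of $\mathbb{F}^{2n}$), over $\mathbb{F}[[x_1,\ldots,x_n]]$ one has $$f(\tau\overline{x}) = k\cdot \prod_{i=1}^{d_0} (y - g_i)^{\gamma_i},$$ where $k\in\mathbb{F}\setminus\{0\}$, each $\gamma_i>0$ is an integer, each $g_i\in\mathbb{F}[[x_1,\ldots,x_n]]$, and the constants $\mu_i := g_i(\overline{0})$ are distinct nonzero elements of $\mathbb{F}$.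
   Context: For $f=\prod_i f_i^{e_i}$ with $f_i$ pairwise coprime irreducible nonconstant and $e_i>0$, $\mathrm{rad}(f):=\prod_i f_i$. $f(\tau\overline{x})$ denotes $f(\alpha_1y+x_1+\beta_1,\ldots,\alpha_ny+x_n+\beta_n)\in\mathbb{F}[\overline{x},y]\subseteq \mathbb{F}[[\overline{x}]][y]$. *)

(* Defs.v *)
From HB Require Import structures.
From mathcomp Require Import all_boot all_order all_algebra.
From mathcomp Require Import freeg mpoly.
From mathcomp Require boolp.

Set Implicit Arguments.
Unset Strict Implicit.
Unset Printing Implicit Defensive.

Import GRing.Theory.
Local Open Scope ring_scope.

(* The ring R[[x_1, ..., x_n]]: a series is its family of coefficients,
   indexed by the exponents 'X_{1..n}, with the Cauchy product. *)
Record fps (n : nat) (R : Type) := FPS { fps_coef : 'X_{1..n} -> R }.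

HB.instance Definition _ n R := boolp.gen_eqMixin (fps n R).
HB.instance Definition _ n R := boolp.gen_choiceMixin (fps n R).

Lemma fpsP n R (u v : fps n R) : fps_coef u =1 fps_coef v <-> u = v.
Proof.
split=> [|-> //]; case: u v => [u] [v] /= uv.
by congr FPS; apply: boolp.funext.
Qed.

Section FpsRing.
Variables (n : nat) (R : comNzRingType).
Implicit Types (u v w : fps n R) (m : 'X_{1..n}).

Definition fps_zero : fps n R := FPS (fun _ => 0).
Definition fps_opp u := FPS (fun m => - fps_coef u m).
Definition fps_add u v := FPS (fun m => fps_coef u m + fps_coef v m).

Lemma fps_addA : associative fps_add.
Proof. by move=> u v w; apply/fpsP=> m; exact: addrA. Qed.

Lemma fps_addC : commutative fps_add.
Proof. by move=> u v; apply/fpsP=> m; exact: addrC. Qed.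

Lemma fps_add0 : left_id fps_zero fps_add.
Proof. by move=> u; apply/fpsP=> m; exact: add0r. Qed.

Lemma fps_addN : left_inverse fps_zero fps_opp fps_add.
Proof. by move=> u; apply/fpsP=> m; exact: addNr. Qed.

HB.instance Definition _ := GRing.isZmodule.Build (fps n R)
  fps_addA fps_addC fps_add0 fps_addN.

Definition fps_of_mpoly (p : {mpoly R[n]}) : fps n R := FPS (fun m => p@_m).

Definition fps_one : fps n R := fps_of_mpoly 1.

Definition fps_mul u v : fps n R := FPS (fun m =>
  \sum_(k : 'X_{1..n < (mdeg m).+1, (mdeg m).+1} | m == (k.1 + k.2)%MM)
    fps_coef u k.1 * fps_coef v k.2).

(* The ring axioms of fps are transferred from {mpoly R[n]} by truncation. *)
Definition fps_trunc b u : {mpoly R[n]} :=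
  \sum_(m : 'X_{1..n < b}) fps_coef u m *: 'X_[m].

Lemma mcoeff_trunc b u m : (mdeg m < b)%N -> (fps_trunc b u)@_m = fps_coef u m.
Proof. exact: mcoeff_mpoly. Qed.

Lemma fps_coefM_poly u v (p q : {mpoly R[n]}) m :
    (forall k, (mdeg k <= mdeg m)%N -> fps_coef u k = p@_k) ->
    (forall k, (mdeg k <= mdeg m)%N -> fps_coef v k = q@_k) ->
  fps_coef (fps_mul u v) m = (p * q)@_m.
Proof.
move=> up vq; rewrite mcoeffM; apply: eq_bigr => -[k l] _ /=.
by rewrite up ?vq // -ltnS bmdeg.
Qed.

Lemma fps_coefM_trunc b u v m : (mdeg m < b)%N ->
  fps_coef (fps_mul u v) m = (fps_trunc b u * fps_trunc b v)@_m.
Proof.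
move=> mb; apply: fps_coefM_poly => k km;
  by rewrite mcoeff_trunc // (leq_ltn_trans km).
Qed.

Lemma fps_mulA : associative fps_mul.
Proof.
move=> u v w; apply/fpsP=> m; set b := (mdeg m).+1.
have T x k : (mdeg k <= mdeg m)%N -> fps_coef x k = (fps_trunc b x)@_k.
  by move=> km; rewrite mcoeff_trunc.
rewrite (@fps_coefM_poly _ _ (fps_trunc b u) (fps_trunc b v * fps_trunc b w)).
- rewrite (@fps_coefM_poly _ _ (fps_trunc b u * fps_trunc b v) (fps_trunc b w)).
  + by rewrite mulrA.
  + by move=> k km; exact: fps_coefM_trunc.
  + exact: T.
- exact: T.
- by move=> k km; exact: fps_coefM_trunc.
Qed.

Lemma fps_mulC : commutative fps_mul.
Proof.
by move=> u v; apply/fpsP=> m; rewrite !(@fps_coefM_trunc (mdeg m).+1) // mulrC.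
Qed.

Lemma fps_mul1 : left_id fps_one fps_mul.
Proof.
move=> u; apply/fpsP=> m.
rewrite (@fps_coefM_poly _ _ 1 (fps_trunc (mdeg m).+1 u)) //.
  by rewrite mul1r mcoeff_trunc.
by move=> k km; rewrite mcoeff_trunc.
Qed.

Lemma fps_mulDl : left_distributive fps_mul fps_add.
Proof.
move=> u v w; apply/fpsP=> m /=; rewrite -big_split /=.
by apply: eq_bigr => k _; rewrite mulrDl.
Qed.

Lemma fps_one_neq0 : fps_one != 0.
Proof.
apply/eqP=> /fpsP/(_ 0%MM) /= /eqP.
by rewrite mcoeff1 eqxx oner_eq0.
Qed.

HB.instance Definition _ := GRing.Zmodule_isComNzRing.Build (fps n R)
  fps_mulA fps_mulC fps_mul1 fps_mulDl fps_one_neq0.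

Lemma fps_of_mpoly_is_zmod_morphism : zmod_morphism fps_of_mpoly.
Proof. by move=> p q; apply/fpsP=> m /=; rewrite mcoeffB. Qed.

Lemma fps_of_mpoly_is_monoid_morphism : monoid_morphism fps_of_mpoly.
Proof. by split=> // p q; apply/fpsP=> m /=; rewrite mcoeffM. Qed.

HB.instance Definition _ := GRing.isZmodMorphism.Build {mpoly R[n]} (fps n R)
  fps_of_mpoly fps_of_mpoly_is_zmod_morphism.
HB.instance Definition _ := GRing.isMonoidMorphism.Build {mpoly R[n]} (fps n R)
  fps_of_mpoly fps_of_mpoly_is_monoid_morphism.

Definition fpsC (c : R) : fps n R := fps_of_mpoly c%:MP.

(* u(0, ..., 0) *)
Definition fps_at0 u : R := fps_coef u 0%MM.

End FpsRing.

Definition mirreducible n (F : fieldType) (p : {mpoly F[n]}) : Prop :=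
  [/\ p != 0, p \isn't a GRing.unit
    & forall a b : {mpoly F[n]}, p = a * b ->
        a \is a GRing.unit \/ b \is a GRing.unit].

Definition mdvd n (F : fieldType) (d p : {mpoly F[n]}) : Prop :=
  exists q : {mpoly F[n]}, p = q * d.

Definition mcoprime n (F : fieldType) (p q : {mpoly F[n]}) : Prop :=
  forall d : {mpoly F[n]}, mdvd d p -> mdvd d q -> d \is a GRing.unit.

(* rad(f) is determined up to a nonzero scalar, hence a relation between f and
   the product of its irreducible factors. *)
Definition is_rad n (F : fieldType) (f r : {mpoly F[n]}) : Prop :=
  exists (s : nat) (p : 'I_s -> {mpoly F[n]}) (e : 'I_s -> nat),
    [/\ forall i, mirreducible (p i),
        forall i j, i != j -> mcoprime (p i) (p j),
        forall i, (0 < e i)%N,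
        f = \prod_(i < s) p i ^+ e i
      & r = \prod_(i < s) p i].

(* msize p is the total degree plus one, and 0 for p = 0. *)
Definition total_degree n (F : fieldType) (p : {mpoly F[n]}) : nat :=
  (msize p).-1.

Definition zariski_closed (m : nat) (F : fieldType) (Z : 'rV[F]_m -> Prop) :
    Prop :=
  exists S : {mpoly F[m]} -> Prop,
    forall v, Z v <-> forall p, S p -> p.@[fun i => v 0 i] = 0.

(* f(alpha_1 y + x_1 + beta_1, ..., alpha_n y + x_n + beta_n) in F[x][y]. *)
Definition tau_subst n (F : fieldType) (alpha beta : 'rV[F]_n)
    (f : {mpoly F[n]}) : {poly {mpoly F[n]}} :=
  mmap (fun c : F => (c%:MP)%:P)
       (fun i => ((alpha 0 i)%:MP)%:P * 'X + ('X_i)%:P + ((beta 0 i)%:MP)%:P)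
       f.

(* Main.v *)
(** Let p(alpha y + beta) be the restriction of p to a line with indeterminate
    direction alpha and base point beta.  The shear beta |-> beta + alpha y is an
    automorphism of F[alpha, beta][y] carrying p(beta) to p(alpha y + beta), so
    the restriction of an irreducible p is again irreducible, and by Gauss's
    lemma it stays irreducible over the field F(alpha, beta).  In characteristic
    0 the restriction of rad(f) is therefore separable of degree d0.  A Bezout
    relation between this restriction and its derivative then gives a nonzero
    polynomial D(alpha, beta) outside of whose zero set rad(f)(alpha y + beta)
    has d0 distinct nonzero roots in F.  These roots are the values at x = 0 of
    roots of f(tau x), obtained by Hensel lifting in F[[x]] along each
    irreducible factor of f. *)

Require Import Defs.
From HB Require Import structures.
From mathcomp Require Import all_boot all_order all_algebra.
From mathcomp Require Import separable.
From mathcomp Require Import freeg mpoly.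
From mathcomp Require Import zify ring.
From mathcomp Require boolp.

Set Implicit Arguments.
Unset Strict Implicit.
Unset Printing Implicit Defensive.

Import GRing.Theory.
Local Open Scope ring_scope.

(** * Factorial domains *)

Section Factorial.
Variable A : idomainType.
Implicit Types a b c p q : A.

Definition divides p a := exists q, a = q * p.

Definition irreducible p :=
  [/\ p != 0, p \isn't a GRing.unit
    & forall a b, p = a * b -> a \is a GRing.unit \/ b \is a GRing.unit].

Definition prime_elt p :=
  [/\ p != 0, p \isn't a GRing.unit
    & forall a b, divides p (a * b) -> divides p a \/ divides p b].

(* Every nonzero element is a unit times a product of primes, stated as the
   induction principle it gives. *)
Definition factorial_domain :=
  forall P : A -> Prop,
    P 1 ->
    (forall u c, u \is a GRing.unit -> P c -> P (u * c)) ->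
    (forall p c, prime_elt p -> P c -> P (p * c)) ->
  forall c, c != 0 -> P c.

(** Induction along the factorization of [p]. A unit factor passes to the cofactor; once a prime
    factor appears, irreducibility forces the rest to be a unit, so [p] is associate to a prime. *)
Lemma irreducible_prime p :
  factorial_domain -> irreducible p -> prime_elt p.
Proof.
move=> facA irrp; have [nzp Nup _] := irrp; move: p nzp irrp Nup.
apply: facA => [|u c uu IHc|p c prp _].
- by rewrite unitr1.
- move=> [nzuc Nuuc irruc] _.
  have nzc : c != 0 by apply: contraNneq nzuc => ->; rewrite mulr0.
  have Nuc : c \isn't a GRing.unit by rewrite unitrMr in Nuuc.
  have irrc : irreducible c.
    split=> // a b eqc; case: (irruc (u * a) b); first by rewrite eqc mulrA.
      by rewrite unitrMr //; left.
    by right.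
  have [_ _ prc] := IHc irrc Nuc; split=> // a b [q eqab].
  case: (prc a b); first by exists (q * u); rewrite eqab !mulrA.
    by case=> q' ->; left; exists (q' * u^-1); rewrite mulrA mulrVK.
  by case=> q' ->; right; exists (q' * u^-1); rewrite mulrA mulrVK.
- move=> [nzpc Nupc irrpc] _; have [nzp Nup prime_p] := prp.
  have uc : c \is a GRing.unit.
    by have [|//] := irrpc p c erefl; rewrite (negPf Nup).
  split=> // a b [q eqab].
  case: (prime_p a b).
  - by exists (q * c); rewrite eqab mulrA mulrAC.
  - by case=> q' ->; left; exists (q' * c^-1); rewrite mulrA mulrAC mulrVK.
  - by case=> q' ->; right; exists (q' * c^-1); rewrite mulrA mulrAC mulrVK.
Qed.

End Factorial.

(** * Gauss's lemma over a factorial domain *)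

Lemma polyZ_inj (A : idomainType) (c : A) :
  c != 0 -> injective (fun p : {poly A} => c *: p).
Proof.
by move=> nzc p q; rewrite -!mul_polyC; apply: mulfI; rewrite polyC_eq0.
Qed.

Lemma poly_split_low (A : idomainType) (c : {poly A}) :
  exists c', c = c' * 'X + (c`_0)%:P /\ (c' = 0 \/ (size c' < size c)%N).
Proof.
elim/poly_ind: c => [|c k _].
  by exists 0; rewrite coef0 mul0r addr0; split=> //; left.
exists c; rewrite coefD coefMX coefC /= add0r; split=> //.
have [->|nzc] := eqVneq c 0; first by left.
by right; rewrite size_MXaddC (negPf nzc).
Qed.

(** Since [p] divides the constant term of [c], it divides [c' * d * 'X]. The constant term of the
    cofactor then vanishes and ['X] cancels. *)
Lemma divides_polyC_shift (A : idomainType) (p e : A) (c c' d : {poly A}) :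
  p != 0 -> c = c' * 'X + (e * p)%:P -> divides p%:P (c * d) ->
  divides p%:P (c' * d).
Proof.
move=> nzp eqc [r eqcd].
have eqX : c' * d * 'X = (r - e%:P * d) * p%:P.
  rewrite mulrBl -eqcd eqc polyCM mulrDl [c' * 'X * d]mulrAC.
  by rewrite [e%:P * d * _]mulrAC addrK.
have r0 : (r - e%:P * d)`_0 = 0.
  have := congr1 (fun r : {poly A} => r`_0) eqX.
  rewrite !coef0M coefX mulr0 coefC eqxx => /esym/eqP.
  by rewrite mulf_eq0 (negPf nzp) orbF => /eqP.
have [r' [eqr _]] := poly_split_low (r - e%:P * d).
have nzX : 'X != 0 :> {poly A} by rewrite polyX_eq0.
by exists r'; apply: (mulIf nzX); rewrite eqX {1}eqr r0 addr0 mulrAC.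
Qed.

(** The product of the two constant terms is divisible by [p], hence one of them is. That term is
    stripped off along with a factor ['X], and induction runs on the sum of the sizes. *)
Lemma prime_polyC (A : idomainType) (p : A) (a b : {poly A}) :
  prime_elt p -> divides p%:P (a * b) -> divides p%:P a \/ divides p%:P b.
Proof.
case=> nzp _ prp; have [N] := ubnP (size a + size b).
elim: N a b => // N IH a b; rewrite ltnS => ltN pab.
have div0 : divides p%:P 0 by exists 0; rewrite mul0r.
have [->|nza] := eqVneq a 0; first by left.
have [->|nzb] := eqVneq b 0; first by right.
have close c c' e : c = c' * 'X + (e * p)%:P -> divides p%:P c' -> divides p%:P c.
  move=> eqc [q' eqc']; exists (q' * 'X + e%:P).
  by rewrite eqc eqc' polyCM mulrDl mulrAC.
have ab0 : divides p (a`_0 * b`_0).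
  have [q eqab] := pab; exists q`_0.
  by have := congr1 (fun r : {poly A} => r`_0) eqab; rewrite !coef0M coefC eqxx.
have [[e eqa0]|[e eqb0]] := prp _ _ ab0.
- have [a' [eqa sza]] := poly_split_low a; rewrite eqa0 in eqa.
  have pa'b := divides_polyC_shift nzp eqa pab.
  case: sza => [a'0|sza]; first by left; apply: close eqa _; rewrite a'0.
  have [||] := IH _ _ _ pa'b; [|by move/(close _ _ _ eqa); left|by right].
  by apply: leq_trans ltN; rewrite ltn_add2r.
- have [b' [eqb szb]] := poly_split_low b; rewrite eqb0 in eqb.
  rewrite mulrC in pab; have pb'a := divides_polyC_shift nzp eqb pab.
  case: szb => [b'0|szb]; first by right; apply: close eqb _; rewrite b'0.
  have [||] := IH _ _ _ pb'a; [|by move/(close _ _ _ eqb); right|by left].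
  by apply: leq_trans ltN; rewrite addnC ltn_add2l.
Qed.


Section Gauss.
Variable A : idomainType.
Hypothesis facA : factorial_domain A.
Implicit Types p q s g : {poly A}.

(** The primes of [c] are cancelled one at a time, each dividing [s] or [g] by [prime_polyC], until
    irreducibility of [p] applies. Hence [p] stays irreducible over the fraction field. *)
Lemma factorial_clear_denom p c s g : c != 0 -> (1 < size p)%N ->
  irreducible p -> c *: p = s * g -> (size s == 1)%N \/ (size g == 1)%N.
Proof.
move=> nzc szp [nzp Nup irrp]; move: c nzc s g.
apply: facA => [s g|u c uu IHc s g|pi c prpi IHc s g].
- rewrite scale1r => /irrp[]; rewrite poly_unitE => /andP[-> _]; by [left|right].
- move=> eqp; have [|su|] := IHc (u^-1 *: s) g; [|left|by right].
    by rewrite -scalerAl -eqp scalerA mulrA mulVr // mul1r.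
  by move: su; rewrite size_scale // invr_eq0;
    apply: contraTneq uu => ->; rewrite unitr0.
- move=> eqp; have [nzpi _ _] := prpi.
  have cancel_pi := polyZ_inj nzpi.
  have [|[s' eqs]|[g' eqg]] := prime_polyC prpi (a := s) (b := g).
  + by exists (c *: p); rewrite -eqp [RHS]mulrC mul_polyC scalerA.
  + rewrite mulrC mul_polyC in eqs.
    rewrite eqs size_scale //; apply: IHc; apply: cancel_pi.
    by rewrite scalerA eqp eqs -scalerAl.
  + rewrite mulrC mul_polyC in eqg.
    rewrite eqg size_scale //; apply: IHc; apply: cancel_pi.
    by rewrite scalerA eqp eqg -scalerAr.
Qed.

(** The relation [%|] allows a nonzero scalar, so it is divisibility over the fraction field. The
    primes of this scalar are cancelled against the cofactor: none divides [p], which is irreducible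
    and nonconstant. *)
Lemma factorial_dvdp p q : (1 < size p)%N -> irreducible p ->
  p %| q -> divides p q.
Proof.
move=> szp [nzp Nup irrp] /Pdiv.Idomain.dvdpP[[c s] /= nzc]; move: c nzc s.
apply: facA => [s|u c uu IHc s|pi c prpi IHc s].
- by rewrite scale1r => ->; exists s.
- move=> eqq; apply: (IHc (u^-1 *: s)).
  by rewrite -scalerAl -eqq scalerA mulrA mulVr // mul1r.
- move=> eqq; have [nzpi Nupi _] := prpi.
  have [|[s' eqs]|[p' eqp]] := prime_polyC prpi (a := s) (b := p).
  + by exists (c *: q); rewrite -eqq [RHS]mulrC mul_polyC scalerA.
  + rewrite mulrC mul_polyC in eqs; apply: (IHc s').
    by apply: (polyZ_inj nzpi); rewrite scalerA eqq eqs -scalerAl.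
  + have [|] := irrp _ _ eqp; last by rewrite poly_unitE coefC eqxx (negPf Nupi) andbF.
    rewrite poly_unitE => /andP[/eqP szp' _]; move: szp.
    by rewrite eqp mulrC mul_polyC size_scale // szp'.
Qed.

(** By [factorial_clear_denom], the gcd of [p] and [q] over the fraction field is either constant or
    [p] up to a scalar. *)
Lemma irreducible_coprime_or_divides p q : (1 < size p)%N -> irreducible p ->
  coprimep p q \/ divides p q.
Proof.
move=> szp irrp; have [nzp _ _] := irrp.
have [cpq|Ncpq] := boolP (coprimep p q); [by left | right].
apply: factorial_dvdp => //.
have /Pdiv.Idomain.dvdpP[[c s] /= nzc eqp] := dvdp_gcdl p q.
have [szs|szg] := factorial_clear_denom nzc szp irrp eqp; last first.
  by rewrite coprimep_def szg in Ncpq.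
apply: dvdp_trans (dvdp_gcdr p q).
have /size_poly1P[k nzk eqs] := szs; rewrite eqs mul_polyC in eqp.
by rewrite -(dvdpZr _ _ nzk) -eqp dvdpZr.
Qed.

(** A constant [p] is a prime of [A]. A nonconstant [p] that is coprime to [a] divides [b] over the
    fraction field, hence already over [A]. *)
Lemma irreducible_poly_prime p : irreducible p -> prime_elt p.
Proof.
move=> irrp; have [nzp Nup ip] := irrp.
have [szp|szp] := leqP (size p) 1.
  have [c eqp] : exists c, p = c%:P by exists p`_0; apply: size1_polyC.
  rewrite eqp in irrp nzp Nup ip *; rewrite polyC_eq0 in nzp.
  have Nuc : c \isn't a GRing.unit by rewrite poly_unitE size_polyC nzp coefC in Nup.
  have prc : prime_elt c.
    apply: irreducible_prime => //; split=> // a b eqab.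
    have := ip a%:P b%:P; rewrite -polyCM -eqab => /(_ erefl).
    by case; rewrite poly_unitE coefC => /andP[_ ?]; [left|right].
  by split=> // [|a b]; [rewrite polyC_eq0 | apply: prime_polyC].
split=> // a b [q eqab].
have [cpa|] := irreducible_coprime_or_divides a szp irrp; [right | by left].
by apply: factorial_dvdp; rewrite // -(Gauss_dvdpr _ cpa) eqab dvdp_mull.
Qed.

End Gauss.

(** * Multivariate polynomials over a field: unique factorization and nonvanishing *)

Lemma mpoly_rmorph_ext n (R : nzRingType) (S : nzRingType)
    (f g : {rmorphism {mpoly R[n]} -> S}) :
  (forall c, f c%:MP = g c%:MP) -> (forall i, f 'X_i = g 'X_i) -> f =1 g.
Proof.
move=> fgC fgX p; rewrite (mpolyE p) !rmorph_sum /=; apply: eq_bigr => m _.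
rewrite -mul_mpolyC !rmorphM /= fgC mpolyXE_id !rmorph_prod /=.
by congr (_ * _); apply: eq_bigr => i _; rewrite !rmorphXn /= fgX.
Qed.

Lemma poly_rmorph_ext (R S : nzRingType) (f g : {rmorphism {poly R} -> S}) :
  (forall c, f c%:P = g c%:P) -> f 'X = g 'X -> f =1 g.
Proof.
move=> fgC fgX; elim/poly_ind => [|p c IHp]; first by rewrite !rmorph0.
by rewrite !rmorphD !rmorphM /= IHp fgC fgX.
Qed.

Section UnitMpoly.
Variables (n : nat) (F : fieldType).
Implicit Types p q : {mpoly F[n]}.

Lemma mpoly_unitE p : (p \is a GRing.unit) = (msize p == 1)%N.
Proof.
apply/idP/msize_poly1P => [/andP[/eqP eqp u0]|[c nzc ->]].
  by exists p@_0; rewrite // -unitfE.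
by apply: rmorph_unit; rewrite unitfE.
Qed.

End UnitMpoly.

Section LastVariable.
Variables (n : nat) (F : comNzRingType).

Definition last_var (i : 'I_n.+1) : {poly {mpoly F[n]}} :=
  if unlift ord_max i is Some j then ('X_j)%:P else 'X.

(** With its inverse [mpoly_of_poly], this singles out the last variable as ['X], which allows
    induction on the number of variables. *)
Definition mpoly_to_poly : {mpoly F[n.+1]} -> {poly {mpoly F[n]}} :=
  mmap (polyC \o @mpolyC n F) last_var.

HB.instance Definition _ := GRing.RMorphism.on mpoly_to_poly.

Definition mpoly_lift : {mpoly F[n]} -> {mpoly F[n.+1]} :=
  mmap (@mpolyC n.+1 F) (fun j => 'X_(fintype.lift ord_max j)).

HB.instance Definition _ := GRing.RMorphism.on mpoly_lift.

Definition mpoly_of_poly : {poly {mpoly F[n]}} -> {mpoly F[n.+1]} :=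
  horner_eval 'X_ord_max \o map_poly mpoly_lift.

HB.instance Definition _ := GRing.RMorphism.on mpoly_of_poly.

Lemma mpoly_to_polyC c : mpoly_to_poly c%:MP = (c%:MP)%:P.
Proof. exact: mmapC. Qed.

Lemma mpoly_to_polyX i : mpoly_to_poly 'X_i = last_var i.
Proof. by rewrite /mpoly_to_poly mmapX mmap1U. Qed.

Lemma mpoly_of_polyC c : mpoly_of_poly c%:P = mpoly_lift c.
Proof. by rewrite /mpoly_of_poly /= map_polyC horner_evalE hornerC. Qed.

Lemma mpoly_of_polyX : mpoly_of_poly 'X = 'X_ord_max.
Proof. by rewrite /mpoly_of_poly /= map_polyX horner_evalE hornerX. Qed.

Lemma mpoly_to_polyK : cancel mpoly_to_poly mpoly_of_poly.
Proof.
apply: (@mpoly_rmorph_ext _ _ _ (mpoly_of_poly \o mpoly_to_poly) idfun) => [c|i] /=.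
  by rewrite mpoly_to_polyC mpoly_of_polyC /mpoly_lift mmapC.
rewrite mpoly_to_polyX /last_var; case: unliftP => [j ->|->].
  by rewrite mpoly_of_polyC /mpoly_lift mmapX mmap1U.
exact: mpoly_of_polyX.
Qed.

Lemma mpoly_of_polyK : cancel mpoly_of_poly mpoly_to_poly.
Proof.
apply: (@poly_rmorph_ext _ _ (mpoly_to_poly \o mpoly_of_poly) idfun) => [c|] /=.
  rewrite mpoly_of_polyC; move: c.
  apply: (@mpoly_rmorph_ext _ _ _ (mpoly_to_poly \o mpoly_lift) polyC) => [c|i] /=.
    by rewrite /mpoly_lift mmapC mpoly_to_polyC.
  by rewrite /mpoly_lift mmapX mmap1U mpoly_to_polyX /last_var liftK.
by rewrite mpoly_of_polyX mpoly_to_polyX /last_var unlift_none.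
Qed.

End LastVariable.

Lemma irreducible_iso (A B : idomainType) (f : {rmorphism A -> B})
    (g : {rmorphism B -> A}) :
  cancel f g -> cancel g f -> forall p : A, irreducible p -> irreducible (f p).
Proof.
move=> fK gK p [nzp Nup irrp]; split=> [||a b eqab].
- by rewrite -(rmorph0 f) (can_eq fK).
- by apply: contra Nup => /(rmorph_unit g); rewrite fK.
have := irrp (g a) (g b); rewrite -rmorphM -eqab fK => /(_ erefl).
by case=> /(rmorph_unit f); rewrite gK; [left|right].
Qed.

Lemma prime_elt_iso (A B : idomainType) (f : {rmorphism A -> B})
    (g : {rmorphism B -> A}) :
  cancel f g -> cancel g f ->
  (forall q : B, irreducible q -> prime_elt q) ->
  forall p : A, irreducible p -> prime_elt p.
Proof.
move=> fK gK irrB p irrp; have [nzp Nup _] := irrp.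
have [_ _ prfp] := irrB _ (irreducible_iso fK gK irrp); split=> // a b [q eqab].
have [|[q' eq']|[q' eq']] := prfp (f a) (f b).
- by exists (f q); rewrite -!rmorphM eqab.
- by left; exists (g q'); rewrite -[a]fK eq' rmorphM fK.
- by right; exists (g q'); rewrite -[b]fK eq' rmorphM fK.
Qed.

Lemma mpoly_factorial_of_prime n (F : fieldType) :
  (forall p : {mpoly F[n]}, irreducible p -> prime_elt p) ->
  factorial_domain {mpoly F[n]}.
Proof.
move=> irr_prime P P1 Pu Pp c nzc; rewrite -[c]mulr1.
(* The goal becomes [P (c * d)] for every [d] with [P d], by induction on the degree of [c]: the two
   factors of a reducible [c] are then absorbed one after the other. *)
move: (1) P1 => d; have [N] := ubnP (msize c).
elim: N c nzc d => // N IH c nzc d; rewrite ltnS => lecN Pd.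
have [uc|Nuc] := boolP (c \is a GRing.unit); first exact: Pu.
have [irrc|redc] := boolp.EM (irreducible c); first exact/Pp/Pd/irr_prime.
have [a [b [eqc Nua Nub]]] : exists a b, [/\ c = a * b,
    a \isn't a GRing.unit & b \isn't a GRing.unit].
  apply: boolp.contrapT => noab; apply: redc; split=> // a b eqc.
  have [ua|Nua] := boolP (a \is a GRing.unit); [by left | right].
  by apply: contraT => Nub; case: noab; exists a, b.
have nza : a != 0 by apply: contraNneq nzc => a0; rewrite eqc a0 mul0r.
have nzb : b != 0 by apply: contraNneq nzc => b0; rewrite eqc b0 mulr0.
rewrite !mpoly_unitE in Nua Nub; rewrite -msize_poly_eq0 in nza.
rewrite -msize_poly_eq0 in nzb.
have szc : msize c = (msize a + msize b).-1.
  by rewrite eqc msizeM // -msize_poly_eq0.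
rewrite eqc -mulrA; apply: (IH); first by rewrite -msize_poly_eq0.
  apply: leq_trans lecN; rewrite szc.
  by case: (msize a) (msize b) nza nzb Nua Nub => [|[|?]] [|[|?]] //= *;
    rewrite !addnS ltnS leq_addr.
apply: IH => //; first by rewrite -msize_poly_eq0.
apply: leq_trans lecN; rewrite szc.
by case: (msize a) (msize b) nza nzb Nua Nub => [|[|?]] [|[|?]] //= *;
  rewrite !addSn ltnS leq_addl.
Qed.

(** Without variables every nonzero element is a unit, so nothing is irreducible. The induction step
    is [irreducible_poly_prime], transported along the isomorphism with univariate polynomials. *)
Lemma mpoly_factorial n (F : fieldType) : factorial_domain {mpoly F[n]}.
Proof.
elim: n => [|n IHn]; apply: mpoly_factorial_of_prime.
  move=> p [nzp Nup _]; case/negP: Nup; rewrite mpoly_unitE.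
  apply/msize_poly1P; exists p@_0; last first.
    apply: msize1_polyC; rewrite msizeE; apply/bigmax_leqP_seq => m _ _.
    by rewrite mdegE big_ord0.
  apply: contraNneq nzp => p0; apply/eqP/mpolyP=> m; rewrite mcoeff0 -p0.
  by congr mcoeff; apply/mnmP => -[].
apply: (prime_elt_iso (@mpoly_to_polyK n F) (@mpoly_of_polyK n F)).
exact: irreducible_poly_prime.
Qed.

Lemma mpoly_nonvanishing n (F : fieldType) (p : {mpoly F[n]}) :
  [pchar F] =i pred0 -> p != 0 -> exists v : 'I_n -> F, p.@[v] != 0.
Proof.
move=> /pcharf0P ch0; elim: n p => [|n IHn] p nzp.
  exists (fun=> 0); apply: contraNneq nzp => pv0.
  have eqp : p = (p@_0)%:MP.
    apply: msize1_polyC; rewrite msizeE; apply/bigmax_leqP_seq => m _ _.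
    by rewrite mdegE big_ord0.
  by move: pv0; rewrite {1}eqp mevalC => p0; rewrite eqp p0 mpolyC0.
pose P := mpoly_to_poly p.
have nzP : P != 0.
  by rewrite -(rmorph0 (@mpoly_to_poly n F)) (can_eq (@mpoly_to_polyK n F)).
have [v nzv] : exists v, (lead_coef P).@[v] != 0.
  by apply: IHn; rewrite lead_coef_eq0.
pose Pv := map_poly (meval v) P.
have nzPv : Pv != 0.
  apply: contraNneq nzv => /(congr1 (fun q : {poly F} => q`_(size P).-1)).
  by rewrite coef_map coef0 lead_coefE => ->.
have [x nzx] : exists x, Pv.[x] != 0.
  (* In characteristic 0 these are [size Pv] distinct elements, one more than the degree of [Pv], so
     they cannot all be roots. *)
  pose s := [seq i%:R : F | i <- iota 0 (size Pv)].
  have us : uniq s.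
    rewrite map_inj_uniq ?iota_uniq // => i j.
    have half k l : (k <= l)%N -> k%:R = l%:R :> F -> k = l.
      move=> le_kl /esym/eqP; rewrite -subr_eq0 -natrB // ch0 subn_eq0 => le_lk.
      by apply/eqP; rewrite eqn_leq le_kl.
    by have [le_ij /(half _ _ le_ij)|/ltnW le_ji /esym/(half _ _ le_ji)] := leqP i j.
  have /allPn[x _ nrx] : ~~ all (root Pv) s.
    apply/negP => rs; have := max_poly_roots nzPv rs us.
    by rewrite size_map size_iota ltnn.
  by exists x.
pose w i := if unlift ord_max i is Some j then v j else x.
exists w; suff -> : p.@[w] = Pv.[x] by [].
have := @mpoly_rmorph_ext _ _ _ (meval w)
  (horner_eval x \o map_poly (meval v) \o @mpoly_to_poly n F).
apply=> [c|i] /=.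
  by rewrite mevalC mpoly_to_polyC map_polyC /= mevalC horner_evalE hornerC.
rewrite mevalXU mpoly_to_polyX /w /last_var horner_evalE.
by case: unlift => [j|]; rewrite ?map_polyC ?map_polyX /= ?mevalXU ?hornerC ?hornerX.
Qed.

Lemma irreducible_polyC (A : idomainType) (p : A) :
  irreducible p -> irreducible p%:P.
Proof.
move=> [nzp Nup irrp]; split=> [||a b eqab].
- by rewrite polyC_eq0.
- by rewrite poly_unitE coefC eqxx (negPf Nup) andbF.
have nzab : a * b != 0 by rewrite -eqab polyC_eq0.
move: (nzab); rewrite mulf_eq0 negb_or => /andP[nza nzb].
have szab : (size a + size b).-1 = 1 by rewrite -size_mul // -eqab size_polyC nzp.
have [sza szb] : size a = 1 /\ size b = 1.
  by rewrite -size_poly_gt0 in nza; rewrite -size_poly_gt0 in nzb; lia.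
have := irrp a`_0 b`_0; rewrite -coef0M -eqab coefC eqxx => /(_ erefl).
by rewrite !poly_unitE sza szb.
Qed.

(** * Restriction of a polynomial to a line *)

Section TopCoef.
Variable R : comNzRingType.
Implicit Types p q : {poly R}.

(** A leading term of formal degree [d]: as [c] may vanish, it is multiplicative even with zero
    divisors. *)
Definition top_coef d c p := (size p <= d.+1)%N /\ p`_d = c.

Lemma top_coef1 : top_coef 0 1 1.
Proof. by rewrite /top_coef size_poly1 coefC. Qed.

Lemma top_coefM d e b c p q :
  top_coef d b p -> top_coef e c q -> top_coef (d + e) (b * c) (p * q).
Proof.
move=> [szp <-] [szq <-]; split.
  by apply: leq_trans (size_polyMleq _ _) _; lia.
have lt_d : (d < (d + e).+1)%N by lia.
rewrite coefM (bigD1 (Ordinal lt_d)) //= addKn big1 ?addr0 // => j.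
rewrite -val_eqE /= => neq_jd; have [lt_jd|le_dj] := ltnP j d.
  by rewrite [q`__]nth_default ?mulr0 //; apply: leq_trans szq _; lia.
by rewrite nth_default ?mul0r //; apply: leq_trans szp _; lia.
Qed.

Lemma top_coefX d c p k : top_coef d c p -> top_coef (d * k) (c ^+ k) (p ^+ k).
Proof.
move=> dcp; elim: k => [|k IHk]; first by rewrite muln0; apply: top_coef1.
by rewrite mulnS !exprS; apply: top_coefM.
Qed.

Lemma top_coef_linear (a b : R) : top_coef 1 a (a *: 'X + b%:P).
Proof.
split; last by rewrite coefD coefZ coefX coefC mulr1 addr0.
apply: leq_trans (size_polyD _ _) _; rewrite geq_max.
rewrite (leq_trans (size_scale_leq _ _)) ?size_polyX //=.
by rewrite (leq_trans (size_polyC_leq1 _)).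
Qed.

End TopCoef.

Section LineSub.
Variables (n : nat) (F B : comNzRingType) (iota : {rmorphism F -> B}).
Variables a b : 'I_n -> B.
Implicit Types p : {mpoly F[n]}.

(** Keeping [iota], [a] and [b] general makes the generic line, its specializations and the
    substitution tau instances of one map. *)
Definition line_sub : {mpoly F[n]} -> {poly B} :=
  mmap (polyC \o iota) (fun i => a i *: 'X + (b i)%:P).

HB.instance Definition _ := GRing.RMorphism.on line_sub.

Lemma line_subC c : line_sub c%:MP = (iota c)%:P.
Proof. exact: mmapC. Qed.

Lemma line_subX i : line_sub 'X_i = a i *: 'X + (b i)%:P.
Proof. by rewrite /line_sub mmapX mmap1U. Qed.

Lemma top_coef_mmap1 m :
  top_coef (mdeg m) (mmap1 a m) (mmap1 (fun i => a i *: 'X + (b i)%:P) m).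
Proof.
rewrite mdegE /mmap1; elim/big_rec3: _ => [|i d c q _ IH].
  exact: top_coef1.
apply: top_coefM => //; rewrite -[d in top_coef d]mul1n.
exact/top_coefX/top_coef_linear.
Qed.

Lemma size_line_sub p : (size (line_sub p) <= msize p)%N.
Proof.
rewrite /line_sub /mmap big_seq; elim/big_ind: _ => [|q r szq szr|m pm].
- by rewrite size_poly0.
- by apply: leq_trans (size_polyD _ _) _; rewrite geq_max szq.
rewrite /= mul_polyC; apply: leq_trans (size_scale_leq _ _) _.
have [szm _] := top_coef_mmap1 m.
exact: leq_trans szm (msize_mdeg_lt pm).
Qed.

(** Only monomials of top degree reach this power of y, and each contributes its value at the
    direction [a]. *)
Lemma coef_line_sub p :
  (line_sub p)`_(msize p).-1 = mmap iota a (pihomog mdeg (msize p).-1 p).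
Proof.
rewrite pihomogE rmorph_sum /= /line_sub {1}/mmap coef_sum [RHS]big_mkcond /=.
rewrite !big_seq; apply: eq_bigr => m pm; rewrite mul_polyC coefZ.
have [szm cm] := top_coef_mmap1 m; case: eqP => [<-|neq].
  by rewrite cm mmapZ mmapX.
rewrite nth_default ?mulr0 //; apply: leq_trans szm _.
by have := msize_mdeg_lt pm; lia.
Qed.

Lemma line_sub_at0 p : (line_sub p).[0] = mmap iota b p.
Proof.
rewrite -horner_evalE; move: p.
apply: (@mpoly_rmorph_ext _ _ _ (horner_eval 0 \o line_sub) (mmap iota b)) => [c|i] /=.
  by rewrite line_subC horner_evalE hornerC mmapC.
by rewrite line_subX horner_evalE !hornerE ?mulr0 ?add0r mmapX mmap1U.
Qed.

End LineSub.

Lemma map_line_sub n (F B C : comNzRingType) (iota : {rmorphism F -> B})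
    (g : {rmorphism B -> C}) (a b : 'I_n -> B) (p : {mpoly F[n]}) :
  map_poly g (line_sub iota a b p) = line_sub (g \o iota) (g \o a) (g \o b) p.
Proof.
move: p; apply: (@mpoly_rmorph_ext _ _ _ (map_poly g \o line_sub iota a b) _) => [c|i] /=.
  by rewrite !line_subC map_polyC.
by rewrite !line_subX rmorphD /= map_polyZ map_polyX map_polyC.
Qed.

Lemma line_sub_ext n (F B : comNzRingType) (iota iota' : {rmorphism F -> B})
    (a a' b b' : 'I_n -> B) :
  iota =1 iota' -> a =1 a' -> b =1 b' ->
  line_sub iota a b =1 line_sub iota' a' b'.
Proof.
move=> ei ea eb; apply: mpoly_rmorph_ext => [c|i] /=.
  by rewrite !line_subC ei.
by rewrite !line_subX ea eb.
Qed.

Lemma pihomog_top_neq0 n (F : comNzRingType) (p : {mpoly F[n]}) :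
  p != 0 -> pihomog mdeg (msize p).-1 p != 0.
Proof.
move=> nzp; have lp := mlead_supp nzp; have dl := mlead_deg nzp.
apply: contraTneq lp => /(congr1 (mcoeff (mlead p))); rewrite mcoeff0.
rewrite pihomogE raddf_sum -big_filter.
rewrite (bigD1_seq (mlead p)) ?filter_uniq ?msupp_uniq //=; last first.
  by rewrite mem_filter -dl eqxx mlead_supp.
rewrite mcoeffZ mcoeffX eqxx mulr1 big1 => [|m neq]; last first.
  by rewrite mcoeffZ mcoeffX (negPf neq) mulr0.
by rewrite addr0 mcoeff_msupp => ->; rewrite eqxx.
Qed.

(** * The line with indeterminate direction and base point *)

Section GenericLine.
Variables (n : nat) (F : fieldType).
Local Notation R := {mpoly F[n + n]}.
Implicit Types p q : {mpoly F[n]}.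

(** The first [n] variables are the direction alpha, the last [n] the base point beta. *)
Definition var_dir (i : 'I_n) : R := 'X_(lshift n i).
Definition var_pt (i : 'I_n) : R := 'X_(rshift n i).

Definition split_sub (S : Type) (h k : 'I_n -> S) (i : 'I_(n + n)) : S :=
  match split i with inl j => h j | inr j => k j end.

Lemma split_subl S (h k : 'I_n -> S) i : split_sub h k (lshift n i) = h i.
Proof. by rewrite /split_sub (unsplitK (inl i)). Qed.

Lemma split_subr S (h k : 'I_n -> S) i : split_sub h k (rshift n i) = k i.
Proof. by rewrite /split_sub (unsplitK (inr i)). Qed.

Definition generic_line : {mpoly F[n]} -> {poly R} :=
  line_sub (@mpolyC (n + n) F) var_dir var_pt.

HB.instance Definition _ := GRing.RMorphism.on generic_line.

Definition in_pt : {mpoly F[n]} -> R := mmap (@mpolyC (n + n) F) var_pt.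
Definition in_dir : {mpoly F[n]} -> R := mmap (@mpolyC (n + n) F) var_dir.

HB.instance Definition _ := GRing.RMorphism.on in_pt.
HB.instance Definition _ := GRing.RMorphism.on in_dir.

(** [at_pt] and [at_dir] set the other block of variables to 0, which gives left inverses of [in_pt]
    and [in_dir]. *)
Definition at_pt : R -> {mpoly F[n]} :=
  mmap (@mpolyC n F) (split_sub (fun=> 0) (fun j => 'X_j)).
Definition at_dir : R -> {mpoly F[n]} :=
  mmap (@mpolyC n F) (split_sub (fun j => 'X_j) (fun=> 0)).

HB.instance Definition _ := GRing.RMorphism.on at_pt.
HB.instance Definition _ := GRing.RMorphism.on at_dir.

Lemma in_ptK : cancel in_pt at_pt.
Proof.
apply: (@mpoly_rmorph_ext _ _ _ (at_pt \o in_pt) idfun) => [c|i] /=.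
  by rewrite /in_pt /at_pt !mmapC.
by rewrite /in_pt /at_pt mmapX mmap1U mmapX mmap1U split_subr.
Qed.

Lemma in_dirK : cancel in_dir at_dir.
Proof.
apply: (@mpoly_rmorph_ext _ _ _ (at_dir \o in_dir) idfun) => [c|i] /=.
  by rewrite /in_dir /at_dir !mmapC.
by rewrite /in_dir /at_dir mmapX mmap1U mmapX mmap1U split_subl.
Qed.

(** The top coefficient is the top homogeneous part of [p] at an indeterminate direction, hence
    nonzero. *)
Lemma size_generic_line p : size (generic_line p) = msize p.
Proof.
have [->|nzp] := eqVneq p 0; first by rewrite rmorph0 size_poly0 msize0.
apply/eqP; rewrite eqn_leq size_line_sub /=.
rewrite (mpolySpred _ nzp) ltnNge; apply/negP => /leq_sizeP/(_ _ (leqnn _)).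
rewrite coef_line_sub -/(in_dir _) => /(congr1 at_dir).
by rewrite in_dirK rmorph0 => /eqP; rewrite (negPf (pihomog_top_neq0 nzp)).
Qed.

Lemma msize_mmap_le k l (h : 'I_k -> {mpoly F[l]}) (p : {mpoly F[k]}) :
  (forall i, (msize (h i) <= 2)%N) ->
  (msize (mmap (@mpolyC l F) h p) <= msize p)%N.
Proof.
move=> szh.
have szM d e (q r : {mpoly F[l]}) : (msize q <= d.+1)%N -> (msize r <= e.+1)%N ->
    (msize (q * r) <= (d + e).+1)%N.
  have [->|nzq] := eqVneq q 0; first by rewrite mul0r msize0.
  have [->|nzr] := eqVneq r 0; first by rewrite mulr0 msize0.
  by rewrite msizeM //; move: (msize q) (msize r) => x y; lia.
have szX (q : {mpoly F[l]}) e : (msize q <= 2)%N -> (msize (q ^+ e) <= e.+1)%N.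
  move=> szq; elim: e => [|e IHe]; first by rewrite expr0 msize1.
  by rewrite exprS; apply: (szM 1 e).
rewrite /mmap big_seq; apply: leq_trans (mmeasure_sum _ _ _ _) _.
apply/bigmax_leqP_seq => m _ pm; rewrite mul_mpolyC.
apply: leq_trans (msizeZ_le _ _) _; apply: leq_trans (msize_mdeg_lt pm).
rewrite mdegE /mmap1; elim/big_rec2: _ => [|i d q _ szq]; first by rewrite msize1.
by apply: szM => //; apply: szX.
Qed.

(** A factorization of p(beta) specializes at alpha = 0 to one of [p]. Neither [in_pt] nor [at_pt]
    raises degrees, so both factors keep theirs, and a factor that becomes a unit was one
    already. *)
Lemma irreducible_in_pt p : irreducible p -> irreducible (in_pt p).
Proof.
move=> [nzp Nup irrp].
have szU m (i : 'I_m) : (msize ('X_i : {mpoly F[m]}) <= 2)%N by rewrite msizeX mdeg1.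
have sz_in q : (msize (in_pt q) <= msize q)%N by apply: msize_mmap_le => i; apply: szU.
have sz_at (q : R) : (msize (at_pt q) <= msize q)%N.
  apply: msize_mmap_le => i; rewrite /split_sub; case: split => j //.
  by rewrite msize0.
have nzip : in_pt p != 0 by rewrite -(rmorph0 in_pt) (can_eq in_ptK).
split=> // [|a b eqab].
  by apply: contra Nup => /(rmorph_unit at_pt) /=; rewrite in_ptK.
have eqp : p = at_pt a * at_pt b by rewrite -rmorphM /= -eqab in_ptK.
have nza : a != 0 by apply: contraNneq nzip => a0; rewrite eqab a0 mul0r.
have nzb : b != 0 by apply: contraNneq nzip => b0; rewrite eqab b0 mulr0.
have nzsa : at_pt a != 0 by apply: contraNneq nzp => a0; rewrite eqp a0 mul0r.
have nzsb : at_pt b != 0 by apply: contraNneq nzp => b0; rewrite eqp b0 mulr0.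
have := irrp _ _ eqp; rewrite !mpoly_unitE.
have := sz_in p; rewrite eqab eqp !msizeM //.
have := sz_at a; have := sz_at b.
rewrite -!msize_poly_eq0 in nza nzb nzsa nzsb.
move: nza nzb nzsa nzsb.
move: (msize a) (msize b) (msize (at_pt a)) (msize (at_pt b)) => x y z w.
by move=> ? ? ? ? ? ? ? [] ?; [left|right]; lia.
Qed.

(* The shear (alpha, beta, y) |-> (alpha, beta + t alpha y, y) is invertible
   and carries p(beta) to p(alpha y + beta) for t = 1. *)
Definition shear_coef (t : F) : R -> {poly R} :=
  mmap (polyC \o @mpolyC (n + n) F)
    (split_sub (fun j => (var_dir j)%:P)
               (fun j => (t *: var_dir j) *: 'X + (var_pt j)%:P)).

HB.instance Definition _ t := GRing.RMorphism.on (shear_coef t).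

Definition shear (t : F) : {poly R} -> {poly R} :=
  horner_eval 'X \o map_poly (shear_coef t).

HB.instance Definition _ t := GRing.RMorphism.on (shear t).

Lemma shearC t c : shear t c%:P = shear_coef t c.
Proof. by rewrite /shear /= map_polyC horner_evalE hornerC. Qed.

Lemma shearX t : shear t 'X = 'X.
Proof. by rewrite /shear /= map_polyX horner_evalE hornerX. Qed.

Lemma shear_coefC t c : shear_coef t c%:MP = c%:MP%:P.
Proof. exact: mmapC. Qed.

Lemma shear_dir t j : shear_coef t (var_dir j) = (var_dir j)%:P.
Proof. by rewrite /shear_coef mmapX mmap1U split_subl. Qed.

Lemma shear_pt t j :
  shear_coef t (var_pt j) = (t *: var_dir j) *: 'X + (var_pt j)%:P.
Proof. by rewrite /shear_coef mmapX mmap1U split_subr. Qed.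

Lemma shearK t : cancel (shear t) (shear (- t)).
Proof.
apply: (@poly_rmorph_ext _ _ (shear (- t) \o shear t) idfun) => [c|] /=; last first.
  by rewrite !shearX.
rewrite shearC; move: c.
apply: (@mpoly_rmorph_ext _ _ _ (shear (- t) \o shear_coef t) polyC) => [c|i] /=.
  by rewrite shear_coefC shearC shear_coefC.
rewrite -[i]splitK; case: (split i) => j /=.
  by rewrite -/(var_dir j) shear_dir shearC shear_dir.
rewrite -/(var_pt j) shear_pt rmorphD /= shearC shear_pt -mul_polyC rmorphM /=.
rewrite shearX shearC -mul_mpolyC rmorphM /= shear_coefC shear_dir -polyCM.
by rewrite mul_mpolyC mul_polyC scaleNr scaleNr addrA subrr add0r.
Qed.

Lemma shear_in_pt p : shear 1 (in_pt p)%:P = generic_line p.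
Proof.
rewrite shearC; move: p.
apply: (@mpoly_rmorph_ext _ _ _ (shear_coef 1 \o in_pt) generic_line) => [c|i] /=.
  by rewrite /in_pt mmapC shear_coefC /generic_line line_subC.
by rewrite /in_pt mmapX mmap1U shear_pt scale1r /generic_line line_subX.
Qed.

Lemma irreducible_msize p : irreducible p -> (1 < msize p)%N.
Proof.
case; rewrite mpoly_unitE -msize_poly_eq0 => nzp Nup _.
by case: (msize p) nzp Nup => [|[|]].
Qed.

Lemma irreducible_generic_line p : irreducible p -> irreducible (generic_line p).
Proof.
move=> irrp; rewrite -shear_in_pt.
have shearK' : cancel (shear (-1)) (shear 1) by rewrite -{2}[1]opprK; apply: shearK.
by apply: (irreducible_iso (shearK 1) shearK');
  apply/irreducible_polyC/irreducible_in_pt.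
Qed.

Lemma generic_line_at0 p : (generic_line p).[0] = in_pt p.
Proof. exact: line_sub_at0. Qed.

(** Setting y = 0 and then alpha = 0 recovers [p] and [q], and carries the cofactor along. *)
Lemma divides_generic_line p q :
  divides (generic_line p) (generic_line q) -> divides p q.
Proof.
case=> u equ; exists (at_pt u.[0]).
have : in_pt q = u.[0] * in_pt p.
  by rewrite -!generic_line_at0 -[in RHS]hornerM -[in RHS]equ.
by move/(congr1 at_pt); rewrite (rmorphM at_pt) /= !in_ptK.
Qed.

Lemma coprimep_generic_line p q : irreducible p -> mcoprime p q ->
  coprimep (generic_line p) (generic_line q).
Proof.
move=> irrp cpq; have [nzp Nup _] := irrp.
have szp : (1 < size (generic_line p))%N.
  by rewrite size_generic_line; apply: irreducible_msize.
have := irreducible_coprime_or_divides (@mpoly_factorial _ F) (generic_line q) szp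
  (irreducible_generic_line irrp).
case=> // /divides_generic_line pq; case/negP: Nup.
by apply: cpq => //; exists 1; rewrite mul1r.
Qed.

(** In characteristic 0 the derivative is nonzero, and its degree is too small for a multiple of the
    irreducible [generic_line p]; so the two are coprime. *)
Lemma separable_generic_line p : [pchar F] =i pred0 -> irreducible p ->
  separable_poly (generic_line p).
Proof.
move=> /pcharf0P ch0 irrp; have [nzp Nup _] := irrp.
have szp : (1 < size (generic_line p))%N.
  by rewrite size_generic_line; apply: irreducible_msize.
rewrite unlock; set P := generic_line p in szp *.
have nzP : P != 0 by rewrite -size_poly_gt0; lia.
have nzP' : P^`() != 0.
  apply/eqP => /(congr1 (fun q : {poly R} => q`_(size P).-2)).
  rewrite coef_deriv coef0.
  have -> : (size P).-2.+1 = (size P).-1 by case: (size P) szp => [|[|]].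
  rewrite -lead_coefE -mulr_natr => /eqP.
  rewrite mulf_eq0 lead_coef_eq0 (negPf nzP) /=.
  rewrite -(rmorph_nat (@mpolyC (n + n) F)) mpolyC_eq0 ch0.
  by case: (size P) szp => [|[|]].
have := irreducible_coprime_or_divides (@mpoly_factorial _ F) P^`() szp
  (irreducible_generic_line irrp).
case=> // -[q eqq]; have nzq : q != 0.
  by apply: contraNneq nzP' => q0; rewrite eqq q0 mul0r.
have := lt_size_deriv nzP; rewrite [P^`()]eqq ltnNge size_mul //.
by rewrite (polySpred nzq) addSn leq_addl.
Qed.

End GenericLine.

(** * Specialization of the generic line *)

Lemma separable_prod (A : idomainType) (I : eqType) (s : seq I) (q : I -> {poly A}) :
  uniq s -> (forall i, separable_poly (q i)) ->
  (forall i j, i != j -> coprimep (q i) (q j)) ->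
  separable_poly (\prod_(i <- s) q i).
Proof.
move=> us sepq coq; elim: s us => [_|i s IHs /= /andP[nis us]].
  by rewrite big_nil unlock derivC coprimep0 eqpxx.
rewrite big_cons separable_mul sepq IHs //=.
elim: s nis {us IHs} => [_|j s IHs]; first by rewrite big_nil coprimep1.
rewrite inE negb_or => /andP[neq nis].
by rewrite big_cons coprimepMr coq // IHs.
Qed.

Lemma map_generic_line n (F : fieldType) (v : 'I_(n + n) -> F)
    (p : {mpoly F[n]}) :
  map_poly (meval v) (generic_line p) =
    line_sub idfun (fun i => v (lshift n i)) (fun i => v (rshift n i)) p.
Proof.
rewrite /generic_line map_line_sub; apply: line_sub_ext => [c|i|i] /=.
- by rewrite mevalC.
- by rewrite mevalXU.
- by rewrite mevalXU.
Qed.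

Lemma generic_line_discriminant n (F : fieldType) (r : {mpoly F[n]}) :
  r != 0 -> separable_poly (generic_line r) ->
  exists2 D : {mpoly F[n + n]}, D != 0 & forall v, D.@[v] != 0 ->
    let L := line_sub idfun (fun i => v (lshift n i))
                            (fun i => v (rshift n i)) r in
    [/\ size L = msize r, L.[0] != 0 & separable_poly L].
Proof.
move=> nzr sepG; pose G := generic_line r.
have {sepG} : coprimep G G^`() by rewrite unlock in sepG.
have nzG : G != 0 by rewrite -size_poly_gt0 size_generic_line lt0n msize_poly_eq0.
case/Bezout_coprimepP=> [[u w] /eqpP[[c1 c2] /= /andP[nzc1 nzc2] bez]].
(* The factors preserve, in order, the degree, the nonzero value at y = 0 and the Bezout relation c1
   (u G + w G') = c2, which stands in for the discriminant. *)
exists (lead_coef G * G.[0] * c2).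
  rewrite !mulf_neq0 ?lead_coef_eq0 // generic_line_at0.
  by rewrite -(rmorph0 (@in_pt n F)) (can_eq (@in_ptK n F)).
move=> v; rewrite !mevalM !mulf_eq0 !negb_or => /andP[/andP[nzl nz0] nzc].
set L := line_sub _ _ _ _.
have eqL : map_poly (meval v) G = L by apply: map_generic_line.
split.
- by rewrite -eqL size_map_poly_id0 // size_generic_line.
- by have := horner_map (meval v) G 0; rewrite rmorph0 /= eqL => ->.
rewrite unlock -eqL deriv_map; apply/Bezout_eq1_coprimepP.
pose k := (c2.@[v])^-1 * c1.@[v].
exists (k *: map_poly (meval v) u, k *: map_poly (meval v) w) => /=.
have := congr1 (map_poly (meval v)) bez.
rewrite !map_polyZ rmorphD !rmorphM rmorph1 /= -!scalerAl -scalerDr -scalerA => ->.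
by rewrite scalerA mulVf // scale1r.
Qed.

(** * Hensel lifting of simple roots *)

Local Arguments fps_at0 : simpl never.

Section Hensel.
Variables (n : nat) (F : fieldType).
Local Notation fps := (fps n F).
Implicit Types (u v : fps) (P Q : {poly fps}).

Lemma fps_at0_is_zmod_morphism : zmod_morphism (@fps_at0 n F).
Proof. by []. Qed.

Lemma fps_at0_is_monoid_morphism : monoid_morphism (@fps_at0 n F).
Proof.
split=> [|u v]; first by rewrite /fps_at0 /= mcoeff1 eqxx.
have lt01 : (mdeg (0%MM : 'X_{1..n}) < 1)%N by rewrite mdeg0.
rewrite /fps_at0 [LHS](fps_coefM_trunc _ _ lt01) rmorphM /=.
by rewrite !mcoeff_trunc.
Qed.

HB.instance Definition _ := GRing.isZmodMorphism.Build fps F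
  (@fps_at0 n F) fps_at0_is_zmod_morphism.
HB.instance Definition _ := GRing.isMonoidMorphism.Build fps F
  (@fps_at0 n F) fps_at0_is_monoid_morphism.

Lemma fps_at0_of_mpoly (p : {mpoly F[n]}) : fps_at0 (fps_of_mpoly p) = p@_0%MM.
Proof. by []. Qed.

Lemma fps_at0C c : fps_at0 (fpsC n c) = c :> F.
Proof. by rewrite fps_at0_of_mpoly mcoeffC eqxx mulr1. Qed.

(* Membership in the N-th power of the maximal ideal. *)
Definition fps_small N u := forall m, (mdeg m < N)%N -> fps_coef u m = 0.

Lemma fps_smallD N u v : fps_small N u -> fps_small N v -> fps_small N (u + v).
Proof. by move=> su sv m lt_mN; rewrite /= su ?sv ?addr0. Qed.

Lemma fps_smallN N u : fps_small N u -> fps_small N (- u).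
Proof. by move=> su m lt_mN; rewrite /= su ?oppr0. Qed.

Lemma fps_smallW M N u : (M <= N)%N -> fps_small N u -> fps_small M u.
Proof. by move=> le_MN su m lt_mM; apply/su/(leq_trans lt_mM). Qed.

Lemma fps_smallM M N u v :
  fps_small M u -> fps_small N v -> fps_small (M + N) (u * v).
Proof.
move=> su sv m lt_m; apply: big1 => -[k1 k2] /= /eqP eqm.
have [lt1|ge1] := ltnP (mdeg k1) M; first by rewrite su ?mul0r.
have eqd : mdeg m = (mdeg k1 + mdeg k2)%N by rewrite [in LHS]eqm mdegD.
rewrite [fps_coef v _]sv ?mulr0 // -(ltn_add2l (mdeg k1)) -eqd.
by apply: leq_trans lt_m _; rewrite leq_add2r.
Qed.

Lemma fps_small0 u : fps_small 0 u.
Proof. by []. Qed.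

Lemma fps_smallMl N u v : fps_small N v -> fps_small N (u * v).
Proof. by move=> sv; rewrite -[N]add0n; apply: fps_smallM. Qed.

Lemma fps_small1 u : fps_at0 u = 0 -> fps_small 1 u.
Proof.
by move=> u0 m; rewrite ltnS leqn0 mdeg_eq0 => /eqP->; apply: u0.
Qed.

Lemma fps_small_eq0 u : (forall N, fps_small N u) -> u = 0.
Proof. by move=> su; apply/fpsP => m; apply: (su (mdeg m).+1). Qed.

Lemma horner_taylor2 (R : comNzRingType) (p : {poly R}) (x h : R) :
  exists e, p.[x + h] = p.[x] + p^`().[x] * h + e * h ^+ 2.
Proof.
elim/poly_ind: p => [|p c [e IHp]].
  by exists 0; rewrite deriv0 !horner0 !mul0r !addr0.
exists (e * x + p^`().[x] + e * h).
rewrite derivD derivM derivX derivC addr0 mulr1 !hornerMXaddC !hornerD hornerMX.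
by rewrite IHp; ring.
Qed.

Lemma horner_small N P u v :
  fps_small N (u - v) -> fps_small N (P.[u] - P.[v]).
Proof.
move=> suv; have [e eqe] := horner_taylor2 P v (u - v).
have -> : P.[u] = P.[v + (u - v)] by rewrite addrC subrK.
rewrite eqe.
have -> : P.[v] + P^`().[v] * (u - v) + e * (u - v) ^+ 2 - P.[v] =
    (P^`().[v] + e * (u - v)) * (u - v) by ring.
exact: fps_smallMl.
Qed.

Lemma fps_at0_horner P u :
  fps_at0 P.[u] = (map_poly (@fps_at0 n F) P).[fps_at0 u].
Proof. by rewrite horner_map. Qed.

Lemma hensel_root P (z : F) :
  root (map_poly (@fps_at0 n F) P) z ->
  (map_poly (@fps_at0 n F) P)^`().[z] != 0 ->
  exists2 g, fps_at0 g = z & root P g.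
Proof.
set P0 := map_poly _ P => rootz; set c := P0^`().[z] => nzc.
(* Newton's iteration with the slope frozen at its constant term [c]: no series is inverted, and
   each step still gains one order. *)
pose newton u := u - fpsC n c^-1 * P.[u].
pose gs k := iter k newton (fpsC n z).
have gsS k : gs k.+1 = gs k - fpsC n c^-1 * P.[gs k] by [].
have at0_gs k : fps_at0 (gs k) = z.
  elim: k => [|k IHk]; first exact: fps_at0C.
  rewrite gsS rmorphB rmorphM /= IHk fps_at0_horner IHk.
  by rewrite (rootP rootz) mulr0 subr0.
have small_gs k : fps_small k.+1 P.[gs k].
  elim: k => [|k IHk].
    by apply: fps_small1; rewrite fps_at0_horner (at0_gs 0%N); apply/rootP.
  rewrite gsS; set u := gs k in IHk *.
  have [e ->] := horner_taylor2 P u (- (fpsC n c^-1 * P.[u])).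
  (* The quadratic Taylor term has order at least 2(k + 1), hence at least k + 2. *)
  rewrite sqrrN; apply: fps_smallD; last first.
    apply: fps_smallMl; rewrite exprMn; apply: fps_smallMl; rewrite expr2.
    by apply: fps_smallW (fps_smallM IHk IHk); lia.
  (* The factor in front of [P.[u]] has constant term 1 - c / c = 0, which gains the missing
     order. *)
  have -> : P.[u] + P^`().[u] * - (fpsC n c^-1 * P.[u]) =
      (1 - P^`().[u] * fpsC n c^-1) * P.[u] by ring.
  rewrite -add1n; apply: fps_smallM IHk; apply: fps_small1.
  rewrite rmorphB rmorph1 rmorphM /= fps_at0C fps_at0_horner at0_gs.
  by rewrite -deriv_map divff ?subrr.
have gs_step k : fps_small k.+1 (gs k.+1 - gs k).
  by rewrite gsS addrC addKr; apply/fps_smallN/fps_smallMl.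
have gs_cauchy k l : (k <= l)%N -> fps_small k.+1 (gs l - gs k).
  elim: l => [|l IHl]; first by rewrite leqn0 => /eqP->; rewrite subrr.
  rewrite leq_eqVlt => /predU1P[->|lt_kl]; first by rewrite subrr.
  rewrite -(subrKA (gs l)); apply: fps_smallD (IHl lt_kl).
  by apply: fps_smallW (gs_step l).
(* The limit: the coefficient at [m] no longer changes from iterate number [mdeg m] on. *)
pose g : fps := FPS (fun m => fps_coef (gs (mdeg m)) m).
have g_lim k : fps_small k.+1 (g - gs k).
  move=> m lt_mk; have := gs_cauchy (mdeg m) k lt_mk m (ltnSn _).
  by move=> /= /eqP; rewrite subr_eq0 => /eqP->; rewrite subrr.
exists g; first exact: (at0_gs (mdeg 0%MM)).
apply/rootP; apply: fps_small_eq0 => -[|k]; first exact: fps_small0.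
rewrite -[P.[g]](subrK P.[gs k]); apply: fps_smallD (small_gs k).
exact: horner_small.
Qed.

(** One simple root is lifted and its linear factor divided out, and the quotient reduces to the
    remaining product. Reduction at x = 0 may lower the degree, so the bound on [size P] is what
    makes the last quotient constant. *)
Lemma hensel_split (s : seq F) P (k : F) :
  uniq s -> k != 0 -> (size P <= (size s).+1)%N ->
  map_poly (@fps_at0 n F) P = k *: \prod_(z <- s) ('X - z%:P) ->
  exists2 g : F -> fps, forall z, z \in s -> fps_at0 (g z) = z &
    P = (P`_(size s))%:P * \prod_(z <- s) ('X - (g z)%:P).
Proof.
move=> us nzk; elim: s us P => [_|z s IHs /= /andP[nzs us]] P szP.
  by exists (fun=> 0) => //; rewrite big_nil mulr1; apply: size1_polyC.
rewrite big_cons => eqP0.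
have [||g0 g0z /factor_theorem[Q defP]] := hensel_root (P := P) (z := z).
- by rewrite eqP0 rootE hornerZ hornerM hornerXsubC subrr mul0r mulr0.
- rewrite eqP0 derivZ derivM derivXsubC mul1r hornerZ hornerD hornerM.
  rewrite hornerXsubC subrr mul0r addr0 mulf_neq0 //.
  by move: nzs; rewrite -root_prod_XsubC.
have szQ : (size Q <= (size s).+1)%N.
  have [->|nzQ] := eqVneq Q 0; first by rewrite size_poly0.
  by move: szP; rewrite defP size_Mmonic ?monicXsubC // size_XsubC addn2.
have eqQ0 : map_poly (@fps_at0 n F) Q = k *: \prod_(z <- s) ('X - z%:P).
  apply: (@mulIf _ ('X - z%:P)); first by rewrite polyXsubC_eq0.
  rewrite -scalerAl [X in _ = k *: X]mulrC -eqP0 [in RHS]defP rmorphM /=.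
  by rewrite map_polyXsubC /= g0z.
have [g gs eqQ] := IHs us Q szQ eqQ0.
exists (fun x => if x == z then g0 else g x) => [x|].
  by rewrite inE; case: eqP => [->|_ /= /gs].
rewrite big_cons eqxx.
have -> : P`_(size s).+1 = Q`_(size s).
  have topX : top_coef 1 1 ('X - g0%:P).
    by rewrite -(scale1r 'X) -polyCN; apply: top_coef_linear.
  have [_] := top_coefM (conj szQ erefl) topX.
  by rewrite addn1 mulr1 -defP.
rewrite [LHS]defP [in LHS]eqQ -mulrA [_ * ('X - _)]mulrC; congr (_ * (_ * _)).
apply: eq_big_seq => x xs; case: eqP => // eqx; by rewrite -eqx xs in nzs.
Qed.

End Hensel.

(** * Factorization of f(tau x) over the power series ring *)

Lemma msize_prod n (F : fieldType) (I : Type) (s : seq I)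
    (p : I -> {mpoly F[n]}) :
  (forall i, p i != 0) ->
  (msize (\prod_(i <- s) p i)).-1 = (\sum_(i <- s) (msize (p i)).-1)%N.
Proof.
move=> nzp; elim: s => [|i s IHs]; first by rewrite !big_nil msize1.
have nzs : \prod_(i <- s) p i != 0.
  by elim/big_ind: _ => // [|x y]; [apply: oner_neq0 | apply: mulf_neq0].
rewrite !big_cons -IHs msizeM // (mpolySpred _ (nzp i)) (mpolySpred _ nzs).
by rewrite addSn addnS.
Qed.

Section TauSubst.
Variables (n : nat) (F : fieldType) (alpha beta : 'rV[F]_n).

Definition tau_fps (f : {mpoly F[n]}) : {poly fps n F} :=
  map_poly (@fps_of_mpoly n F) (tau_subst alpha beta f).

Definition tau_line : {mpoly F[n]} -> {poly F} :=
  line_sub idfun (alpha 0) (beta 0).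

HB.instance Definition _ := GRing.RMorphism.on tau_line.

(** Grouping x_i + beta_i as the base point turns tau into the restriction to a line of constant
    direction alpha. *)
Lemma tau_subst_line f : tau_subst alpha beta f =
  line_sub (@mpolyC n F) (fun i => (alpha 0 i)%:MP)
           (fun i => 'X_i + (beta 0 i)%:MP) f.
Proof.
move: f; apply: (@mpoly_rmorph_ext _ _ _
  (mmap (polyC \o @mpolyC n F) (fun i => ((alpha 0 i)%:MP)%:P * 'X + ('X_i)%:P
     + ((beta 0 i)%:MP)%:P)) _) => [c|i] /=.
  by rewrite mmapC line_subC.
by rewrite mmapX mmap1U line_subX polyCD mul_polyC addrA.
Qed.

Lemma tau_fpsX f e : tau_fps (f ^+ e) = tau_fps f ^+ e.
Proof. by rewrite /tau_fps !tau_subst_line !rmorphXn. Qed.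

Lemma tau_fps_prod I (s : seq I) (p : I -> {mpoly F[n]}) :
  tau_fps (\prod_(i <- s) p i) = \prod_(i <- s) tau_fps (p i).
Proof.
rewrite /tau_fps tau_subst_line !rmorph_prod.
by apply: eq_bigr => i _; rewrite tau_subst_line.
Qed.

Lemma size_tau_fps f : (size (tau_fps f) <= msize f)%N.
Proof.
rewrite /tau_fps tau_subst_line map_line_sub; exact: size_line_sub.
Qed.

(** This coefficient depends only on the direction alpha, whose entries lie in F; so it is a
    constant series. *)
Lemma coef_tau_fps f :
  (tau_fps f)`_(msize f).-1 = fpsC n (tau_line f)`_(msize f).-1.
Proof.
rewrite /tau_fps tau_subst_line coef_map !coef_line_sub /fpsC; congr fps_of_mpoly.
move: (pihomog _ _ _); apply: (@mpoly_rmorph_ext _ _ _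
  (mmap (@mpolyC n F) (fun i => (alpha 0 i)%:MP))
  (@mpolyC n F \o mmap idfun (alpha 0))) => [c|i] /=.
  by rewrite !mmapC.
by rewrite !mmapX !mmap1U.
Qed.

Lemma map_at0_tau_fps f : map_poly (@fps_at0 n F) (tau_fps f) = tau_line f.
Proof.
rewrite /tau_fps tau_subst_line !map_line_sub; apply: line_sub_ext => [c|i|i] /=.
- exact: fps_at0C.
- exact: fps_at0C.
- by rewrite fps_at0_of_mpoly mcoeffD mcoeffX mcoeffC eqxx mnm1_eq0 mulr1 add0r.
Qed.

End TauSubst.

(** The roots at x = 0 are simple by separability, so all of them lift. As the degree does not drop
    at x = 0, the leading coefficient is the constant [k]. *)
Lemma tau_fps_split (F : closedFieldType) n (alpha beta : 'rV[F]_n)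
    (p : {mpoly F[n]}) :
  p != 0 -> size (tau_line alpha beta p) = msize p ->
  separable_poly (tau_line alpha beta p) ->
  exists k (L : seq (fps n F)), [/\ k != 0,
    tau_line alpha beta p = k *: \prod_(u <- L) ('X - (fps_at0 u)%:P) &
    tau_fps alpha beta p = (fpsC n k)%:P * \prod_(u <- L) ('X - u%:P)].
Proof.
move=> nzp szL; set T := tau_line _ _ _ in szL *.
have [s defT] := closed_field_poly_normal T; set k := lead_coef T in defT.
have nzT : T != 0 by rewrite -size_poly_eq0 szL msize_poly_eq0.
have nzk : k != 0 by rewrite lead_coef_eq0.
rewrite defT (eqp_separable (eqp_scale _ nzk)) separable_prod_XsubC => us.
have szs : size s = (msize p).-1.
  by rewrite -szL defT size_scale // size_prod_XsubC.
have := hensel_split us nzk _ (etrans (map_at0_tau_fps alpha beta p) defT).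
case=> [|g gs defP].
  by rewrite szs -mpolySpred // size_tau_fps.
exists k, [seq g z | z <- s]; rewrite !big_map; split=> //.
  by congr (_ *: _); apply: eq_big_seq => z /gs ->.
by rewrite defP szs coef_tau_fps -szL -lead_coefE.
Qed.

Theorem theorem3p2 (F : closedFieldType) (n : nat) (f r : {mpoly F[n]})
    (d0 : nat) :
  [pchar F] =i pred0 ->
  is_rad f r ->
  d0 = total_degree r ->
  (0 < d0)%N ->
  exists Z : 'rV[F]_(n + n) -> Prop,
    [/\ zariski_closed Z,
        exists v, ~ Z v
      & forall alpha beta : 'rV[F]_n, ~ Z (row_mx alpha beta) ->
          exists (k : F) (gamma : 'I_d0 -> nat) (g : 'I_d0 -> fps n F),
            [/\ k != 0,
                forall i, (0 < gamma i)%N,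
                injective (fun i => fps_at0 (g i)),
                forall i, fps_at0 (g i) != 0
              & map_poly (@fps_of_mpoly n F) (tau_subst alpha beta f)
                = (fpsC n k)%:P
                  * \prod_(i < d0) ('X - (g i)%:P) ^+ gamma i]].
Proof.
move=> ch0 [s [p [e [irrp cop gt0e -> ->]]]] -> gt0d.
have nzp i : p i != 0 by have [] := irrp i.
have nzr : \prod_(i < s) p i != 0 by apply/prodf_neq0 => i _.
set r0 := \prod_(i < s) p i in gt0d nzr *.
have sepG : separable_poly (generic_line r0).
  rewrite rmorph_prod; apply: separable_prod; first exact: index_enum_uniq.
    by move=> i; apply: separable_generic_line => //; apply: irrp.
  by move=> i j neq_ij; apply: coprimep_generic_line; [apply: irrp | apply: cop].
have [D nzD goodD] := generic_line_discriminant nzr sepG.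
exists (fun v => D.@[fun i => v 0 i] = 0); split.
- by exists (eq D) => v; split=> [Dv q <-|/(_ _ erefl)].
- have [v nzv] := mpoly_nonvanishing ch0 nzD; exists (\row_i v i) => /eqP.
  by rewrite (meval_eq (v2 := v)) ?(negPf nzv) // => i; rewrite mxE.
move=> alpha beta /eqP /goodD; set L := line_sub _ _ _ _.
have {L}-> : L = tau_line alpha beta r0.
  by apply: line_sub_ext => // i; rewrite ?row_mxEl ?row_mxEr.
case=> szT T0 sepT.
pose T i := tau_line alpha beta (p i).
have defT : tau_line alpha beta r0 = \prod_(i < s) T i by rewrite rmorph_prod.
have szTi i : size (T i) = msize (p i).
  apply/eqP; rewrite eqn_leq size_line_sub /= (mpolySpred _ (nzp i)).
  pose c j := (T j)`_(msize (p j)).-1.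
  (* The formal top coefficients multiply to that of the whole product, which is nonzero since [r0]
     keeps its degree on the line; hence no factor loses degree. *)
  have [_ coefT] : top_coef (\sum_(j < s) (msize (p j)).-1) (\prod_(j < s) c j)
      (\prod_(j < s) T j).
    elim/big_rec3: _ => [|j d b q _]; first exact: top_coef1.
    apply: top_coefM; split=> //; rewrite -mpolySpred //.
    exact: size_line_sub.
  have : \prod_(j < s) c j != 0.
    rewrite -coefT -defT -msize_prod // -/r0 -szT -lead_coefE lead_coef_eq0.
    by rewrite -size_poly_eq0 szT msize_poly_eq0.
  move/prodf_neq0/(_ i isT); rewrite ltnNge; apply: contra => le_sz.
  by rewrite /c nth_default.
have sepTi i : separable_poly (T i).
  by apply: dvdp_separable sepT; rewrite defT (bigD1 i) //= dvdp_mulr.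
have := fun i => tau_fps_split (nzp i) (szTi i) (sepTi i).
case/fin_all_exists=> k /fin_all_exists[L /all_and3[nzk defTi defPi]].
(* All lifted roots, each paired with the exponent in f of the irreducible factor it comes from. *)
pose M := flatten [seq [seq (e i, u) | u <- L i] | i <- enum 'I_s].
have bigM (R : comNzRingType) (h : nat -> fps n F -> R) :
    \prod_(x <- M) h x.1 x.2 = \prod_(i < s) \prod_(u <- L i) h (e i) u.
  rewrite big_flatten big_map big_enum /=; apply: eq_bigr => i _.
  by rewrite big_map.
have nzK : \prod_(i < s) k i != 0 by apply/prodf_neq0.
have defTM : tau_line alpha beta r0 =
    (\prod_(i < s) k i) *: \prod_(x <- M) ('X - (fps_at0 x.2)%:P).
  rewrite defT (bigM _ (fun _ u => 'X - (fps_at0 u)%:P)) -mul_polyC rmorph_prod.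
  rewrite -big_split /=; apply: eq_bigr => i _.
  by rewrite /T defTi mul_polyC.
pose mu := [seq fps_at0 x.2 | x <- M].
have defTmu : tau_line alpha beta r0 =
    (\prod_(i < s) k i) *: \prod_(z <- mu) ('X - z%:P) by rewrite big_map.
(* Separability of the whole product also keeps apart roots coming from different factors. *)
have umu : uniq mu.
  by rewrite -separable_prod_XsubC -(eqp_separable (eqp_scale _ nzK)) -defTmu.
have mu0 : 0 \notin mu.
  rewrite -root_prod_XsubC; move: T0; rewrite defTmu hornerZ mulf_eq0 negb_or.
  by case/andP.
have szmu : size mu = size M by rewrite size_map.
(* Comparing degrees in y shows that there are exactly d0 roots. *)
have szM : size M = total_degree r0.
  by rewrite /total_degree -szT defTmu size_scale // size_prod_XsubC szmu.
have ltM (i : 'I_(total_degree r0)) : (i < size M)%N by rewrite szM.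
(* A default for [nth] that is never returned: all indices stay below [size M]. *)
pose x0 : nat * fps n F := (1%N, 0).
have nth_mu (i : 'I_(total_degree r0)) : fps_at0 (nth x0 M i).2 = nth 0 mu i.
  by rewrite (nth_map x0) ?ltM.
exists (\prod_(i < s) k i ^+ e i), (fun i => (nth x0 M i).1),
  (fun i => (nth x0 M i).2).
split.
- by apply/prodf_neq0 => i _; rewrite expf_neq0.
- move=> i; have /flatten_mapP[j _ /mapP[u _ ->]] : nth x0 M i \in M.
    by rewrite mem_nth ?ltM.
  exact: gt0e.
- move=> i j; rewrite !nth_mu => /eqP.
  by rewrite nth_uniq ?szmu ?ltM // => /eqP/val_inj.
- move=> i; rewrite nth_mu.
  by apply: contraNneq mu0 => <-; rewrite mem_nth ?szmu ?ltM.
rewrite -/(tau_fps alpha beta _) tau_fps_prod.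
(* The intermediate product over [M] links indexing by position in [M] with the double product over
   irreducible factors and their roots. *)
transitivity ((fpsC n (\prod_(i < s) k i ^+ e i))%:P *
    \prod_(x <- M) ('X - x.2%:P) ^+ x.1); last first.
  by rewrite (big_nth x0) szM big_mkord.
rewrite (bigM _ (fun d u => ('X - u%:P) ^+ d)) /fpsC !rmorph_prod -big_split /=.
apply: eq_bigr => i _; rewrite tau_fpsX defPi exprMn prodrXl.
by rewrite !rmorphXn.
Qed.
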